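(* For every integer $n\ge2$, the zero ideal of $\mathbb C[X_1,\ldots,X_n]$ is not of type C.
   Context: $\mathbb C[X_1,\ldots,X_n]$ is regarded as a $*$-algebra with the involution (conjugate-linear) for which $X_j^*=X_j$ for all $j$. A complex linear functional $\Lambda:\mathbb C[X_1,\ldots,X_n]\to\mathbb C$ is positive definite if $\Lambda(R^*R)\ge0$ for all $R$; for such $\Lambda$ put $\mathcal I^{\mathsf c}_\Lambda=\{R:\Lambda(R^*R)=0\}$. $\Lambda$ is a moment functional if there is a positive Borel measure $\mu$ on $\mathbb R^n$, with respect to which all polynomials are absolutely integrable, such that $\Lambda(R)=\int_{\mathbb R^n}R\,d\mu$ for all $R\in\mathbb C[X_1,\ldots,X_n]$. A $*$-ideal $I$ of $\mathbb C[X_1,\ldots,X_n]$ (an ideal closed under the involution) is of type C if every positive definite complex linear functional $\Lambda$ on $\mathbb C[X_1,\ldots,X_n]$ satisfying $\mathcal I^{\mathsf c}_\Lambda=I$ is a moment functional. *)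

(* Defs.v *)
From HB Require Import structures.
From mathcomp Require Import all_boot all_order all_algebra.
From mathcomp Require Import all_classical all_reals all_analysis.
From mathcomp Require Import complex.
(* The notations of [mpoly] conflict with those of MathComp-Analysis. *)
From mathcomp Require Import (canonicals) mpoly.

Set Implicit Arguments.
Unset Strict Implicit.
Unset Printing Implicit Defensive.

Import Order.TTheory GRing.Theory Num.Theory.
Import numFieldNormedType.Exports.

Local Open Scope classical_set_scope.
Local Open Scope ring_scope.
Local Open Scope complex_scope.

Notation Cpoly R n := (mpoly.mpoly n (complex R)).

(* The conjugate-linear involution fixing the variables: it conjugates the
   coefficients; [pstarX] ... [pstarK] below confirm this. *)
Definition pstar (R : realType) (n : nat) (p : Cpoly R n) : Cpoly R n :=
  mpoly.map_mpoly (@conjc R) p.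

Lemma pstarX (R : realType) (n : nat) (j : 'I_n) :
  pstar (mpoly.mpolyX R[i] (mpoly.mnm1 j)) = mpoly.mpolyX R[i] (mpoly.mnm1 j).
Proof. by rewrite /pstar mpoly.map_mpolyX. Qed.

Lemma pstarD (R : realType) (n : nat) (p q : Cpoly R n) :
  pstar (p + q) = pstar p + pstar q.
Proof. exact: raddfD. Qed.

Lemma pstarZ (R : realType) (n : nat) (c : R[i]) (p : Cpoly R n) :
  pstar (c *: p) = c^* *: pstar p.
Proof.
apply/mpoly.mpolyP=> m.
rewrite mpoly.mcoeff_map_mpoly !mpoly.mcoeffZ mpoly.mcoeff_map_mpoly.
exact: (rmorphM (@conjc R)).
Qed.

Lemma pstarM (R : realType) (n : nat) (p q : Cpoly R n) :
  pstar (p * q) = pstar p * pstar q.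
Proof. exact: rmorphM. Qed.

Lemma pstarK (R : realType) (n : nat) : involutive (@pstar R n).
Proof.
move=> p; apply/mpoly.mpolyP=> m; rewrite !mpoly.mcoeff_map_mpoly.
exact: conjcK.
Qed.

Lemma pstar0 (R : realType) (n : nat) : pstar 0 = 0 :> Cpoly R n.
Proof. exact: raddf0. Qed.

Record star_ideal (R : realType) (n : nat) := StarIdeal {
  ideal_set :> set (Cpoly R n);
  ideal0 : ideal_set 0;
  idealD : forall p q, ideal_set p -> ideal_set q -> ideal_set (p + q);
  idealM : forall p q, ideal_set q -> ideal_set (p * q);
  ideal_star : forall p, ideal_set p -> ideal_set (pstar p)
}.

Section zero_ideal.
Variables (R : realType) (n : nat).

Let zero_set : set (Cpoly R n) := [set 0].

Let zeroD p q : zero_set p -> zero_set q -> zero_set (p + q).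
Proof. by move=> -> ->; rewrite /zero_set /= addr0. Qed.

Let zeroM p q : zero_set q -> zero_set (p * q).
Proof. by move=> ->; rewrite /zero_set /= mulr0. Qed.

Let zero_star p : zero_set p -> zero_set (pstar p).
Proof. by move=> ->; exact: pstar0. Qed.

Definition zero_ideal : star_ideal R n :=
  @StarIdeal R n [set 0] erefl zeroD zeroM zero_star.
End zero_ideal.

(* In [R[i]], [0 <= z] means that [z] is real and nonnegative. *)
Definition positive_definite (R : realType) (n : nat)
    (L : {scalar (Cpoly R n)}) : Prop :=
  forall p : Cpoly R n, 0 <= L (pstar p * p).

Definition null_set (R : realType) (n : nat) (L : {scalar (Cpoly R n)}) :
    set (Cpoly R n) :=
  [set p | L (pstar p * p) = 0].

(* R^n with its Borel sigma-algebra *)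
Notation borel_space R n := (g_sigma_algebraType (@open 'rV[R]_n)).

Definition peval (R : realType) (n : nat) (p : Cpoly R n) (x : 'rV[R]_n) :
    R[i] :=
  mpoly.meval (fun j => (x ord0 j)%:C) p.

Definition moment_functional (R : realType) (n : nat)
    (L : {scalar (Cpoly R n)}) : Prop :=
  exists mu : {measure set (borel_space R n) -> \bar R},
    (forall p : Cpoly R n,
       mu.-integrable setT (fun x => (Normc.normc (peval p x))%:E)) /\
    (forall p : Cpoly R n,
       L p = Rintegral mu setT (fun x => complex.Re (peval p x))
             +i* Rintegral mu setT (fun x => complex.Im (peval p x))).

Definition type_C (R : realType) (n : nat) (I : star_ideal R n) : Prop :=
  forall L : {scalar (Cpoly R n)},
    positive_definite L -> null_set L = I -> moment_functional L.

(* Main.v *)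
Require Import Defs.
From HB Require Import structures.
From mathcomp Require Import all_boot all_order all_algebra.
From mathcomp Require Import all_classical all_reals all_analysis.
From mathcomp Require Import complex zify ring.
From mathcomp Require Import (canonicals, coercions) mpoly.

(* Motzkin's polynomial x^4 y^2 + x^2 y^4 + 1 - 3 x^2 y^2 is nonnegative, so a
   moment functional is nonnegative on it.  A functional L that is strictly
   positive on squares and negative on Motzkin's polynomial is given by
   explicit, very fast growing moments: L vanishes on the monomials that are
   not squares, and L(X^(2m)) = 16^(h m) with h m = 4^(level m + n).
   - If level m < max (level a) (level b) whenever a <> b and a + b = 2m, then
     4 h m <= h a + h b, so that the Gram matrix (L(X^(a+b)))_(a,b) is
     diagonally dominant after rescaling.
   - If moreover level (1,1) exceeds the level of (2,1), (1,2) and (0,0), then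
     L is negative on Motzkin's polynomial.
   Although (1,1) is the barycenter of (2,1), (1,2) and (0,0), it is not the
   midpoint of two lattice points of that triangle, so a strictly convex
   function raised at the single point (1,1) meets both requirements. *)

Set Implicit Arguments.
Unset Strict Implicit.
Unset Printing Implicit Defensive.

Import Order.TTheory GRing.Theory Num.Theory.

Local Open Scope ring_scope.

Notation monomial n := (mpoly.multinom n).
Local Notation "a +m b" := (mpoly.mnm_add a b)
  (at level 50, left associativity).

(** * Diagonally dominant Hermitian forms *)

Section dominance.
Variable C : numClosedFieldType.

(** With [u x = |a x| * d x], the inequality of arithmetic and geometric means bounds each
    off-diagonal term by half of [c x ^+ 2 * u y ^+ 2 + c y ^+ 2 * u x ^+ 2]. These bounds add up to
    at most the sum of the [c x ^+ 2] times that of the [u x ^+ 2]. *)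
Lemma hermitian_form_dominant (T : eqType) (r : seq T) (a c d : T -> C)
    (K : T -> T -> C) :
  uniq r -> (forall x, 0 <= c x) -> (forall x, 0 <= d x) ->
  (forall x y, (K x y)^* = K y x) -> (forall x, K x x = d x ^+ 2) ->
  (forall x y, x != y -> `|K x y| <= c x * d x * (c y * d y)) ->
  (1 - \sum_(x <- r) c x ^+ 2) * (\sum_(x <- r) (`|a x| * d x) ^+ 2) <=
    \sum_(x <- r) \sum_(y <- r) (a x)^* * a y * K x y.
Proof.
move=> r_uniq c_ge0 d_ge0 KC Kdiag Koff.
pose u x := `|a x| * d x; pose F x y := (a x)^* * a y * K x y.
have u_ge0 x : 0 <= u x by rewrite mulr_ge0.
set U := \sum_(x <- r) (`|a x| * d x) ^+ 2.
set S := \sum_(x <- r) _; set th := \sum_(x <- r) c x ^+ 2.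
pose E := \sum_(x <- r) \sum_(y <- r | y != x) F x y.
have SE : S = U + E.
  rewrite /S /U /E -big_split /=; apply: eq_big_seq => x xr.
  rewrite (bigD1_seq x) //=; congr (_ + _).
  by rewrite Kdiag exprMn normCKC.
have Ureal : U \is Num.real.
  by apply: ger0_real; apply: sumr_ge0 => x _; rewrite exprn_ge0 ?u_ge0.
(* The final comparison needs a real [E]: conjugation swaps the two indices of [S], so [S] is
   self-conjugate. *)
have Ereal : E \is Num.real.
  suff Sreal : S \is Num.real by rewrite -(addKr U E) -SE realD ?realN.
  apply/CrealP; rewrite rmorph_sum /= /S exchange_big /=.
  apply: eq_bigr => x _; rewrite rmorph_sum /=; apply: eq_bigr => y _.
  by rewrite !rmorphM /= conjCK KC [a x * _]mulrC.
have Fle x y : y != x ->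
    `|F x y| <= (c x ^+ 2 * u y ^+ 2 + c y ^+ 2 * u x ^+ 2) / 2.
  move=> yx; rewrite /F !normrM norm_conjC.
  have h1 : `|a x| * `|a y| * `|K x y| <= (c x * u y) * (c y * u x).
    have -> : (c x * u y) * (c y * u x) =
      `|a x| * `|a y| * (c x * d x * (c y * d y)) by rewrite /u; ring.
    by rewrite ler_wpM2l ?mulr_ge0 // Koff // eq_sym.
  apply: le_trans h1 _; rewrite -subr_ge0.
  have -> : (c x ^+ 2 * u y ^+ 2 + c y ^+ 2 * u x ^+ 2) / 2
      - c x * u y * (c y * u x) = (c x * u y - c y * u x) ^+ 2 / 2 by field.
  apply: divr_ge0 => //; apply: real_exprn_even_ge0 => //.
  by rewrite realB // ger0_real // mulr_ge0.
have Ele : `|E| <= th * U.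
  apply: (@le_trans _ _ (\sum_(x <- r) \sum_(y <- r)
      (c x ^+ 2 * u y ^+ 2 + c y ^+ 2 * u x ^+ 2) / 2)).
    apply: le_trans (ler_norm_sum _ _ _) _; apply: ler_sum => x _.
    apply: le_trans (ler_norm_sum _ _ _) _.
    rewrite [leRHS](bigID (fun y => y != x)) /= -[leLHS]addr0 lerD //.
      by apply: ler_sum => y; apply: Fle.
    apply: sumr_ge0 => y _.
    by rewrite divr_ge0 // addr_ge0 // mulr_ge0 // exprn_ge0.
  under eq_bigr do rewrite -mulr_suml big_split /= -mulr_sumr -mulr_suml.
  rewrite -mulr_suml big_split /= -mulr_suml -mulr_sumr -/th -/U.
  by rewrite [leLHS](_ : _ = th * U) //; field.
rewrite SE mulrBl mul1r lerD2l.
exact: real_lerNnormlW.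
Qed.

End dominance.

(** * Geometric sums over monomials *)

Lemma sum_geometric_half (F : numFieldType) (N : nat) :
  \sum_(j < N) (2 ^- j.+1 : F) = 1 - 2 ^- N.
Proof.
elim: N => [|N IH]; first by rewrite big_ord0 expr0 invr1 subrr.
by rewrite big_ord_recr /= IH exprS; field; rewrite expf_neq0 // pnatr_eq0.
Qed.

(** The weight is the product of the [2 ^- (m i).+1], so over the box of exponents below [N] it sums
    to [(1 - 2 ^- N) ^+ n]. The box contains [r] once [N] exceeds all degrees in [r]. *)
Lemma sum_monomial_weight_lt1 (F : numFieldType) (n : nat)
    (r : seq (monomial n)) : (0 < n)%N -> uniq r ->
  \sum_(m <- r) 2 ^- (mpoly.mdeg m + n) < 1 :> F.
Proof.
move=> n_gt0 r_uniq.
pose N := (\max_(m <- r) mpoly.mdeg m).+1.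
have mN (m : monomial n) i : m \in r -> (m i < N)%N.
  move=> mr; rewrite ltnS; apply: leq_trans (leq_bigmax_seq _ mr isT).
  by rewrite mpoly.mdegE (bigD1 i) //= leq_addr.
pose g (m : monomial n) : {ffun 'I_n -> 'I_N} := [ffun i => inord (m i)].
have g_inj : {in r &, injective g}.
  move=> x y xr yr /ffunP gE; apply/mpoly.mnmP => i.
  by have /(congr1 val) := gE i; rewrite !ffunE /= !inordK ?mN.
pose G (f : {ffun 'I_n -> 'I_N}) : F := \prod_(i < n) 2 ^- (f i).+1.
have -> : \sum_(m <- r) 2 ^- (mpoly.mdeg m + n) = \sum_(f <- map g r) G f.
  rewrite big_map; apply: eq_big_seq => m mr; rewrite /G.
  under eq_bigr do rewrite ffunE inordK ?mN //.
  rewrite prodfV prodrXr; congr (_ ^- _).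
  under eq_bigr do rewrite -addn1.
  by rewrite big_split /= mpoly.mdegE sum1_card card_ord.
rewrite big_uniq ?map_inj_in_uniq //=.
apply: (@le_lt_trans _ _ (\sum_f G f)).
  rewrite [leRHS](bigID (mem (map g r))) /= lerDl.
  apply: sumr_ge0 => f _; apply: prodr_ge0 => i _.
  by rewrite invr_ge0 exprn_ge0.
rewrite /G -(bigA_distr_bigA (fun _ (j : 'I_N) => 2 ^- j.+1)) /=.
rewrite prodr_const card_ord sum_geometric_half.
rewrite exprn_ilt1 -?lt0n //.
by rewrite subr_ge0 invf_le1 ?exprn_gt0 // exprn_ege1 // ler1n.
Qed.

(** * Discrete convexity of the level *)

Local Open Scope nat_scope.

(** For [m = a + d] and [b = a + 2 * d] the defect is [2 * d ^ 2]. *)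
Lemma sqrn_midpoint (a b m : nat) :
  a + b = m + m -> 2 * m ^ 2 + (a != b) <= a ^ 2 + b ^ 2.
Proof.
wlog ab : a b / a <= b => [th abm|abm].
  case/orP: (leq_total a b) => ?; first exact: th.
  by rewrite eq_sym [leqRHS]addnC th // addnC.
have [d mE] : exists d, m = a + d by exists (m - a); lia.
have {abm ab} -> : b = a + d + d by lia.
by rewrite mE -!mulnn; case: d {mE} => [|d]; nia.
Qed.

(* Minkowski gauge, centered at (1,1), of the triangle with vertices (0,0),
   (2,1), (1,2): it is 1 at the vertices and at least 2 at every other lattice
   point but (1,1), where it is 0.  Truncation at 0 is harmless, because the
   three untruncated linear forms add up to 0. *)
Definition gauge (x y : nat) : nat :=
  maxn (x + y - 2) (maxn (x.+1 - 2 * y) (y.+1 - 2 * x)).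

(** A maximum of affine forms is convex. *)
Lemma gauge_midpoint (x y a b c d : nat) :
  a + c = x + x -> b + d = y + y -> 2 * gauge x y <= gauge a b + gauge c d.
Proof.
move=> ac bd.
have ge u v : [/\ u + v - 2 <= gauge u v, u.+1 - 2 * v <= gauge u v
    & v.+1 - 2 * u <= gauge u v].
  by rewrite /gauge !leq_max !leqnn !orbT.
have [? ? ?] := ge a b; have [? ? ?] := ge c d.
by rewrite [gauge x y]/gauge !maxnMr !geq_max; apply/and3P; split; lia.
Qed.

Section level.
Variables (n : nat) (i0 i1 : 'I_n).
Hypothesis i01 : i0 != i1.

Definition pair_monomial (a b : nat) : monomial n :=
  mpoly.mnm_muln (mpoly.mnm1 i0) a +m mpoly.mnm_muln (mpoly.mnm1 i1) b.

Local Notation bump := (pair_monomial 1 1).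

(** The gauge is convex but not strictly so; the squares make the sum strictly convex in every
    direction. *)
Definition base_level (m : monomial n) : nat :=
  8 * gauge (m i0) (m i1) + \sum_i m i ^ 2.

(* The convex value at (1,1) is 2.  The value 15 lies strictly between 8 + 5, at
   (2,1) and (1,2), and 8 * 2, which bounds below the level at points of gauge
   at least 2, one of which belongs to each pair with midpoint (1,1). *)
Definition level (m : monomial n) : nat :=
  if m == bump then 15 else base_level m.

Lemma sum_two_variables (m : monomial n) (f : nat -> nat) :
  f 0 = 0 -> (forall i, i != i0 -> i != i1 -> m i = 0) ->
  \sum_i f (m i) = f (m i0) + f (m i1).
Proof.
move=> f0 m0; rewrite (bigD1 i0) //= (bigD1 i1) 1?eq_sym //= big1 ?addn0 //.
by move=> i /andP[? ?]; rewrite m0.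
Qed.

Lemma base_level_midpoint (a b m : monomial n) :
  a +m b = m +m m -> a != b -> 2 * base_level m < base_level a + base_level b.
Proof.
move=> /mpoly.mnmP abE ab.
have ab2 i : a i + b i = m i + m i by have := abE i; rewrite !mpoly.mnmDE.
have g2 : 2 * gauge (m i0) (m i1) <= gauge (a i0) (a i1) + gauge (b i0) (b i1).
  by apply: gauge_midpoint; apply: ab2.
suff : 2 * (\sum_i m i ^ 2) < \sum_i a i ^ 2 + \sum_i b i ^ 2.
  by rewrite /base_level; lia.
have [k abk] : exists k, a k != b k.
  apply/existsP; rewrite -negb_forall; apply: contra ab => /forallP abk.
  by apply/eqP/mpoly.mnmP => i; apply/eqP.
rewrite big_distrr /= -big_split /= (bigD1 k) //= [ltnRHS](bigD1 k) //= -addSn.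
apply: leq_add.
  by have := sqrn_midpoint (ab2 k); rewrite abk addn1.
apply: leq_sum => i _; apply: leq_trans (sqrn_midpoint (ab2 i)).
by rewrite leq_addr.
Qed.

Lemma pair_monomial_i0 (a b : nat) : pair_monomial a b i0 = a.
Proof.
by rewrite mpoly.mnmDE !mpoly.mulmnE !mpoly.mnm1E eqxx eq_sym (negPf i01); lia.
Qed.

Lemma pair_monomial_i1 (a b : nat) : pair_monomial a b i1 = b.
Proof.
by rewrite mpoly.mnmDE !mpoly.mulmnE !mpoly.mnm1E eqxx (negPf i01); lia.
Qed.

Lemma pair_monomial_other (a b : nat) i :
  i != i0 -> i != i1 -> pair_monomial a b i = 0.
Proof.
move=> /negPf ii0 /negPf ii1.
by rewrite mpoly.mnmDE !mpoly.mulmnE !mpoly.mnm1E ![_ == i]eq_sym ii0 ii1.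
Qed.

Lemma base_level_pair (a b : nat) :
  base_level (pair_monomial a b) = 8 * gauge a b + (a ^ 2 + b ^ 2).
Proof.
rewrite /base_level (sum_two_variables (f := fun k => k ^ 2)) //;
  last exact: pair_monomial_other.
by rewrite pair_monomial_i0 pair_monomial_i1.
Qed.

Lemma base_level_le (m : monomial n) : base_level m <= level m.
Proof.
rewrite /level; case: eqP => // ->.
by rewrite base_level_pair.
Qed.

Lemma level_midpoint (a b m : monomial n) :
  a +m b = m +m m -> a != b -> level m < maxn (level a) (level b).
Proof.
move=> abE ab.
have := base_level_le a; have := base_level_le b.
rewrite {3}/level; case: eqP => [mE|_]; last first.
  by have := base_level_midpoint abE ab; lia.
have abi i : a i + b i = m i + m i.
  by move/mpoly.mnmP: abE => /(_ i); rewrite !mpoly.mnmDE.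
have := abi i0; have := abi i1.
rewrite mE pair_monomial_i0 pair_monomial_i1 => a1 a0.
(* At [bump], one of [a] and [b] has gauge at least 2, hence level at least 16. Otherwise both have
   exponents 1 at [i0] and [i1], and 0 elsewhere, so they coincide. *)
suff : (a i0 != 1) || (a i1 != 1).
  move=> aN1.
  have : 2 <= maxn (gauge (a i0) (a i1)) (gauge (b i0) (b i1)).
    by rewrite /gauge; lia.
  by rewrite /base_level; lia.
rewrite -negb_and; apply: contra ab => /andP[/eqP a01 /eqP a11].
apply/eqP/mpoly.mnmP => i; have := abi i; rewrite mE.
have [->|ii0] := eqVneq i i0; first by lia.
have [->|ii1] := eqVneq i i1; first by lia.
by rewrite pair_monomial_other //; lia.
Qed.

Lemma mdeg_le_level (m : monomial n) : mpoly.mdeg m <= level m.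
Proof.
apply: leq_trans (base_level_le m).
rewrite mpoly.mdegE /base_level; apply: leq_trans (leq_addl _ _).
by apply: leq_sum => i _; nia.
Qed.

Lemma level_pair_lt (a b : nat) : (a, b) != (1, 1) ->
  8 * gauge a b + (a ^ 2 + b ^ 2) < 15 ->
  level (pair_monomial a b) < level bump.
Proof.
move=> ab1 lt15; rewrite {2}/level eqxx /level.
case: eqP => [/mpoly.mnmP abE|_]; last by rewrite base_level_pair.
have := abE i0; have := abE i1.
rewrite !pair_monomial_i0 !pair_monomial_i1 => b1 a1.
by rewrite a1 b1 eqxx in ab1.
Qed.

End level.

(** * The moments and their growth *)

Section moment_sequence.
Variables (n : nat) (i0 i1 : 'I_n).
Hypothesis i01 : i0 != i1.

(** Base 4 turns one step of the level into the factor 4 of [log_weight_midpoint]; the shift by [n]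
    matches the exponent in [sum_monomial_weight_lt1]. *)
Definition log_weight (m : monomial n) : nat := 4 ^ (level i0 i1 m + n).

(* Rounds down, so m is a square iff it is twice its half. *)
Definition half_monomial (m : monomial n) : monomial n :=
  mpoly.Multinom [tuple (m i)./2 | i < n].

(** The base 16 is read in two ways: as [4 ^ 2] on the diagonal of the Gram matrix, and as [2 ^ 4]
    off it, where the 4 is absorbed by [log_weight_midpoint]. *)
Definition moment_seq (m : monomial n) : nat :=
  if half_monomial m +m half_monomial m == m
  then 16 ^ log_weight (half_monomial m) else 0.

Lemma half_monomialD (m : monomial n) : half_monomial (m +m m) = m.
Proof.
apply/mpoly.mnmP => i.
by rewrite mpoly.multinomE tnth_mktuple mpoly.mnmDE addnn doubleK.
Qed.

Lemma moment_seq_double (m : monomial n) :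
  moment_seq (m +m m) = 16 ^ log_weight m.
Proof. by rewrite /moment_seq half_monomialD eqxx. Qed.

Lemma moment_seq_pair (a b : nat) :
  moment_seq (pair_monomial i0 i1 (a + a) (b + b)) =
  16 ^ log_weight (pair_monomial i0 i1 a b).
Proof.
rewrite -moment_seq_double; congr moment_seq; apply/mpoly.mnmP => i.
by rewrite !mpoly.mnmDE !mpoly.mulmnE !mulnDr addnACA.
Qed.

Lemma log_weight_midpoint (a b m : monomial n) :
  a +m b = m +m m -> a != b -> 4 * log_weight m <= log_weight a + log_weight b.
Proof.
move=> abE ab; rewrite -expnS -addSn.
have := level_midpoint i01 abE ab; rewrite leq_max => /orP[] lt_m.
  by apply: leq_trans (leq_addr _ _); rewrite leq_exp2l // leq_add2r.
by apply: leq_trans (leq_addl _ _); rewrite leq_exp2l // leq_add2r.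
Qed.

Lemma moment_seqD_le (a b : monomial n) : a != b ->
  moment_seq (a +m b) <= 2 ^ (log_weight a + log_weight b).
Proof.
move=> ab; rewrite /moment_seq; case: eqP => // abE.
by rewrite -[16]/(2 ^ 4) -expnM leq_exp2l // log_weight_midpoint.
Qed.

Lemma mdeg_le_log_weight (m : monomial n) : mpoly.mdeg m + n <= log_weight m.
Proof.
apply: leq_trans (ltnW (ltn_expl _ _)) => //.
by rewrite leq_add2r mdeg_le_level.
Qed.

End moment_sequence.

Local Close Scope nat_scope.

(** * The linear functional with prescribed moments *)

Section moment_linear.
Variables (C : comNzRingType) (n : nat) (w : monomial n -> C).

Definition moment_form (p : mpoly.mpoly n C) : C :=
  \sum_(m <- mpoly.msupp p) mpoly.mcoeff m p * w m.

(** Linearity compares polynomials with different supports; this allows one common list for all of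
    them. *)
Lemma moment_form_seq (r : seq (monomial n)) (p : mpoly.mpoly n C) :
  uniq r -> {subset mpoly.msupp p <= r} ->
  moment_form p = \sum_(m <- r) mpoly.mcoeff m p * w m.
Proof.
move=> r_uniq pr; rewrite [RHS](bigID (mem (mpoly.msupp p))) /=.
rewrite [X in _ + X]big1 ?addr0 => [|m /mpoly.memN_msupp_eq0 ->]; last first.
  by rewrite mul0r.
rewrite -big_filter; apply: perm_big; apply: uniq_perm.
- exact: mpoly.msupp_uniq.
- exact: filter_uniq.
by move=> m; rewrite mem_filter /= andb_idr // => /pr.
Qed.

Lemma moment_form_is_scalar : scalar moment_form.
Proof.
move=> a p q.
pose r := undup (mpoly.msupp (a *: p + q) ++ mpoly.msupp p ++ mpoly.msupp q).
have r_uniq : uniq r by exact: undup_uniq.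
rewrite !(moment_form_seq r_uniq) => [|m|m|m]; rewrite ?mem_undup ?mem_cat.
- rewrite mulr_sumr -big_split /=; apply: eq_bigr => m _.
  by rewrite mpoly.mcoeffD mpoly.mcoeffZ mulrDl mulrA.
- by move=> ->; rewrite !orbT.
- by move=> ->; rewrite orbT.
- by move=> ->.
Qed.

HB.instance Definition _ := GRing.isLinear.Build C (mpoly.mpoly n C) C *%R
  moment_form moment_form_is_scalar.

Lemma moment_formX (m : monomial n) : moment_form (mpoly.mpolyX C m) = w m.
Proof.
by rewrite /moment_form mpoly.msuppX big_seq1 mpoly.mcoeffX eqxx mul1r.
Qed.

End moment_linear.

Local Open Scope complex_scope.

Lemma moment_form_pstarM (R : realType) (n : nat) (w : monomial n -> R[i])
    (p : Cpoly R n) :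
  moment_form w (pstar p * p) =
  \sum_(a <- mpoly.msupp p) \sum_(b <- mpoly.msupp p)
    (mpoly.mcoeff a p)^*%R * mpoly.mcoeff b p * w (a +m b).
Proof.
have pE := mpoly.mpolyE p.
have psE : pstar p =
    \sum_(a <- mpoly.msupp p) (mpoly.mcoeff a p)^* *: mpoly.mpolyX _ a.
  rewrite {1}pE /pstar raddf_sum /=; apply: eq_bigr => a _.
  by rewrite -/(pstar _) pstarZ /pstar mpoly.map_mpolyX.
rewrite psE {3}pE mulr_suml linear_sum /=; apply: eq_bigr => a _.
rewrite mulr_sumr linear_sum /=; apply: eq_bigr => b _.
rewrite -scalerAl -scalerAr -mpoly.mpolyXD !linearZ /= moment_formX.
by rewrite mulrA.
Qed.

Lemma motzkin_real_ge0 (F : realFieldType) (a b : F) :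
  0 <= a ^+ 4 * b ^+ 2 + a ^+ 2 * b ^+ 4 + 1 - 3 * a ^+ 2 * b ^+ 2.
Proof.
have -> : a ^+ 4 * b ^+ 2 + a ^+ 2 * b ^+ 4 + 1 - 3 * a ^+ 2 * b ^+ 2 =
    (a ^+ 2) ^+ 2 * b ^+ 2 + a ^+ 2 * (b ^+ 2) ^+ 2 + 1 - 3 * a ^+ 2 * b ^+ 2.
  by ring.
rewrite -(real_normK (num_real a)) -(real_normK (num_real b)).
move: `|a| `|b| (normr_ge0 a) (normr_ge0 b) => s t s0 t0.
(* The factor [2 * (s * t) + 1] is nonnegative because [s] and [t] are absolute values. *)
have -> : (s ^+ 2) ^+ 2 * t ^+ 2 + s ^+ 2 * (t ^+ 2) ^+ 2 + 1
      - 3 * s ^+ 2 * t ^+ 2 =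
    (s * t) ^+ 2 * (s - t) ^+ 2 + (s * t - 1) ^+ 2 * (2 * (s * t) + 1) by ring.
have st0 : 0 <= 2 * (s * t) + 1 by rewrite addr_ge0 // mulr_ge0 // mulr_ge0.
by apply: addr_ge0; apply: mulr_ge0 => //; apply: sqr_ge0.
Qed.

(** * The functional separating squares from Motzkin's polynomial *)

Section counterexample.
Variables (R : realType) (n : nat) (i0 i1 : 'I_n).
Hypothesis i01 : i0 != i1.

Let w (m : monomial n) : R[i] := (moment_seq i0 i1 m)%:R.
Let X (a b : nat) : Cpoly R n := mpoly.mpolyX _ (pair_monomial i0 i1 a b).

Definition motzkin_functional : {scalar (Cpoly R n)} := moment_form w.

(** Yields both positivity and the triviality of the null set; [e] may depend on [p], since only its
    sign matters. *)
Lemma motzkin_functional_ge (p : Cpoly R n) : exists2 e : R[i], 0 < e &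
  e * (\sum_(m <- mpoly.msupp p)
         (`|mpoly.mcoeff m p| * 4 ^+ log_weight i0 i1 m) ^+ 2)
    <= motzkin_functional (pstar p * p).
Proof.
pose h := log_weight i0 i1.
exists (1 - \sum_(m <- mpoly.msupp p) (2 ^- h m) ^+ 2).
  rewrite subr_gt0.
  have n_gt0 : (0 < n)%N by apply: leq_ltn_trans (ltn_ord i0).
  apply: le_lt_trans (sum_monomial_weight_lt1 _ n_gt0 (mpoly.msupp_uniq p)).
  apply: ler_sum => m _; rewrite exprVn -exprM lef_pV2 ?posrE ?exprn_gt0 //.
  rewrite ler_eXn2l ?ltr1n //; apply: leq_trans (mdeg_le_log_weight i01 m) _.
  by rewrite leq_pmulr.
rewrite /motzkin_functional /= moment_form_pstarM.

(* Here [d = 4 ^+ h] is the square root of the diagonal entry, and [c = 2 ^- h] makes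
   [c * d = 2 ^+ h], as in [moment_seqD_le]. *)
apply: (@hermitian_form_dominant _ _ _ (fun m => mpoly.mcoeff m p)
  (fun m => 2 ^- h m) (fun m => 4 ^+ h m) (fun a b => w (a +m b))).
- exact: mpoly.msupp_uniq.
- by move=> m; rewrite invr_ge0 exprn_ge0.
- by move=> m; rewrite exprn_ge0.
- by move=> a b; rewrite /w conjC_nat mpoly.addmC.
- by move=> a; rewrite /w moment_seq_double -exprM mulnC exprM -natrX natrX.
move=> a b ab; rewrite /w normr_nat.
have E m : 2 ^- h m * 4 ^+ h m = 2 ^+ h m :> R[i].
  by rewrite -exprVn -exprMn; congr (_ ^+ _); field.
by rewrite !E -exprD -natrX ler_nat; apply: moment_seqD_le.
Qed.

Lemma motzkin_functional_positive : positive_definite motzkin_functional.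
Proof.
move=> p; have [e e0 /(le_trans _)] := motzkin_functional_ge p; apply.
apply: mulr_ge0; first exact: ltW.
by apply: sumr_ge0 => m _; rewrite exprn_ge0 ?mulr_ge0 ?exprn_ge0.
Qed.

Lemma motzkin_functional_null :
  Defs.null_set motzkin_functional = zero_ideal R n.
Proof.
apply/seteqP; split=> [p|p ->]; rewrite /Defs.null_set /=; last first.
  by rewrite mulr0 linear0.
move=> pp0; have [e e0] := motzkin_functional_ge p.
have -> : motzkin_functional (pstar p * p) = 0 by exact: pp0.
rewrite pmulr_rle0 // => le0.
apply/mpoly.mpolyP => m; rewrite mpoly.mcoeff0.
have [mp|/mpoly.memN_msupp_eq0 //] := boolP (m \in mpoly.msupp p).
have sq_ge0 k : 0 <= (`|mpoly.mcoeff k p| * 4 ^+ log_weight i0 i1 k) ^+ 2.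
  by rewrite exprn_ge0 ?mulr_ge0 ?exprn_ge0.
have /eqP : \sum_(k <- mpoly.msupp p)
    (`|mpoly.mcoeff k p| * 4 ^+ log_weight i0 i1 k) ^+ 2 = 0.
  by apply: le_anti; rewrite le0 sumr_ge0.
rewrite psumr_eq0 => //.
move/allP => /(_ _ mp) /=; rewrite expf_eq0 /= mulf_eq0 expf_eq0.
by rewrite pnatr_eq0 andbF orbF normr_eq0 => /eqP.
Qed.

Definition motzkin : Cpoly R n := X 4 2 + X 2 4 + X 0 0 - 3 *: X 2 2.

Lemma peval_motzkin_ge0 (x : 'rV[R]_n) : 0 <= complex.Re (peval motzkin x).
Proof.
have -> : peval motzkin x =
  (let a := x ord0 i0 in let b := x ord0 i1 in
    a ^+ 4 * b ^+ 2 + a ^+ 2 * b ^+ 4 + 1 - 3 * a ^+ 2 * b ^+ 2)%:C.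
  rewrite /peval; set v := fun j => _.
  have XE a b : mpoly.meval v (X a b) = v i0 ^+ a * v i1 ^+ b.
    rewrite /X mpoly.mpolyXD mpoly.mevalM -!mpoly.mpolyXn.
    by rewrite !rmorphXn /= !mpoly.mevalXU.
  rewrite /motzkin mpoly.mevalB !mpoly.mevalD mpoly.mevalZ !XE /v /=.
  rewrite !(rmorphB, rmorphD, rmorphM, rmorphXn, rmorph1, rmorph_nat) /=.
  by ring.
exact: motzkin_real_ge0.
Qed.

Lemma motzkin_functional_motzkin : motzkin_functional motzkin < 0.
Proof.
(* Each of the three moments added in [motzkin] is below the moment of [X 2 2], which is subtracted
   three times. *)
have moment_lt a b : (a, b) != (1, 1)%N ->
    (8 * gauge a b + (a ^ 2 + b ^ 2) < 15)%N ->
    (moment_seq i0 i1 (pair_monomial i0 i1 (a + a) (b + b)) <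
     moment_seq i0 i1 (pair_monomial i0 i1 (1 + 1) (1 + 1)))%N.
  move=> ab1 ab15; rewrite !moment_seq_pair.
  rewrite ltn_exp2l // /log_weight ltn_exp2l // ltn_add2r.
  exact: level_pair_lt.
have := moment_lt 2%N 1%N isT isT; have := moment_lt 1%N 2%N isT isT.
have := moment_lt 0%N 0%N isT isT.
rewrite /motzkin_functional /motzkin linearB !linearD linearZ /= !moment_formX.
rewrite /w subr_lt0 -natrM -!natrD ltr_nat.
do 4!move: (moment_seq _ _ _) => ?.
by lia.
Qed.

Lemma motzkin_functional_not_moment : ~ moment_functional motzkin_functional.
Proof.
case=> mu [_ muE]; have := motzkin_functional_motzkin.
rewrite muE ltcE /= => /andP[_]; rewrite ltNge => /negP; apply.
by apply: Rintegral_ge0 => x _; apply: peval_motzkin_ge0.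
Qed.

End counterexample.

Theorem mainTheorem7 (R : realType) (n : nat) (hn : (2 <= n)%N) :
  ~ type_C (zero_ideal R n).
Proof.
have i01 : Ordinal (ltnW hn) != Ordinal hn by [].
move=> typeC; apply: (motzkin_functional_not_moment (R := R) i01).
apply: typeC; first exact: motzkin_functional_positive.
exact: motzkin_functional_null.
Qed.
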